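(* Let $G$ be a finite group. Then for all $m\geq 0$: $$\dim H_{m}(\mathcal{L}G)\leq \sum_{1<H<G}\dim\widetilde H_{m-1}(\mathcal{L}H),$$ $$\dim H_{m}(\mathcal{C}G)\leq \sum_{1\leq H<G}|G:H|\,\dim\widetilde H_{m-1}(\mathcal{C}H),$$ $$\dim H_{m}(\mathcal{S}G)\leq \sum_{1<H<G}|G:H|\,\dim\widetilde H_{m-1}(\mathcal{S}H),$$ where the first and third sums run over all nontrivial proper subgroups $H$ of $G$ and the second sum runs over all proper subgroups $H$ of $G$ (including the trivial one).
   Context: For a finite poset $P$, $\Delta P$ denotes its order complex (simplices are the nonempty finite chains of $P$), and $H_m(P)$, $\widetilde H_m(P)$ mean the integral (resp. reduced integral) homology of $\Delta P$. For an abelian group, $\dim$ means its torsion-free rank. Conventions: $\widetilde H_{-1}(\emptyset)=\mathbb Z$, $\widetilde H_m(\emptyset)=0$ for $m\neq -1$, and $\widetilde H_m(X)=0$ for $m<0$ and $X\neq\emptyset$. For a finite group $G$ (all posets ordered by inclusion): $\mathcal{L}G=\{H\mid 1<H<G\}$ is the poset of nontrivial proper subgroups of $G$; $\mathcal{C}G=\{xH\mid H<G,\ x\in G\}$ is the poset of all left cosets of all proper subgroups of $G$ (the trivial subgroup included); $\mathcal{S}G$ is obtained from $\mathcal{C}G$ by removing the one-element cosets $\{g\}$, $g\in G$. *)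

(* Defs.v *)
From HB Require Import structures.
From mathcomp Require Import all_boot all_order all_algebra all_fingroup.
From mathcomp Require Import boolp classical_sets.
From mathcomp Require Import zify.

Set Implicit Arguments.
Unset Strict Implicit.
Unset Printing Implicit Defensive.

Import Order.DefaultSetSubsetOrder Order.TTheory GRing.Theory Num.Theory.
Local Open Scope ring_scope.

Section TorsionFreeRank.
Variable A : zmodType.

Definition Zfree n (s : 'I_n -> A) : Prop :=
  forall c : 'I_n -> int, \sum_i s i *~ c i = 0 -> forall i, c i = 0.

Definition is_tfrank (r : nat) : Prop :=
  (exists s : 'I_r -> A, Zfree s) /\
  (forall n (s : 'I_n -> A), Zfree s -> (n <= r)%N).

(* The default value 0 is only reached when the rank is infinite, which never
   happens for the groups used here: see is_tfrank_homology and
   is_tfrank_reduced_homology. *)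
Definition tfrank : nat := xget 0%N is_tfrank.

Lemma tfrankP (b : nat) :
  (forall n (s : 'I_n -> A), Zfree s -> (n <= b)%N) -> is_tfrank tfrank.
Proof.
move=> le_b; pose p n := `[< exists s : 'I_n -> A, Zfree s >].
have p0 : exists n, p n by exists 0%N; apply/asboolP; exists (fun=> 0) => c _ [].
have p_le n : p n -> (n <= b)%N by move=> /asboolP[s]; apply: le_b.
have [r /asboolP r_free r_max] := ex_maxnP p0 p_le.
apply: (xgetPex 0%N); exists r; split=> // n s s_free.
by apply: r_max; apply/asboolP; exists s.
Qed.

End TorsionFreeRank.

Lemma Zfree_ffun (I : finType) n (s : 'I_n -> {ffun I -> int}) :
  Zfree s -> (n <= #|I|)%N.
Proof.
move=> s_free; rewrite leqNgt; apply/negP=> lt_In.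
pose M : 'M[rat]_(n, #|I|) := \matrix_(i, j) (s i (enum_val j))%:~R.
have: kermx M != 0.
  by rewrite -mxrank_eq0 mxrank_ker -lt0n subn_gt0 (leq_ltn_trans (rank_leq_col M)).
case/rowV0Pn=> v /sub_kermxP vM /eqP; apply; apply/rowP=> i; rewrite mxE.
pose c j := numq (v 0 j) * \prod_(l | l != j) denq (v 0 l).
have cE j : (c j)%:~R = v 0 j * (\prod_l denq (v 0 l))%:~R :> rat.
  rewrite (bigD1 j) //= !rmorphM /= mulrA; congr (_ * _).
  exact: numqE.
suff /s_free/(_ i)/(congr1 (fun z => z%:~R : rat)) : \sum_j s j *~ c j = 0.
  rewrite cE /= => /eqP; rewrite mulf_eq0 intr_eq0 => /orP[/eqP//|/prodf_eq0[l _]].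
  by rewrite (negPf (denq_neq0 _)).
apply/ffunP=> x; apply: (@intr_inj rat); rewrite sum_ffunE !ffunE rmorph_sum /=.
have := congr1 (fun w : 'rV_ _ => w 0 (enum_rank x) * (\prod_l denq (v 0 l))%:~R) vM.
rewrite !mxE mul0r mulr_suml => E; rewrite -[RHS]E; apply: eq_bigr => j _.
by rewrite mxE enum_rankK mulrAC -cE ffunMzE mulrzz rmorphM mulrC.
Qed.

(* The homology ker g / im f of A --f--> B --g--> C. *)
Section HomologyAt.
Variables (A B C : zmodType) (f : {additive A -> B}) (g : {additive B -> C}).

Definition cycle_pred : {pred B} := fun z => g z == 0.

Fact cycle_zmod_closed : zmod_closed cycle_pred.
Proof.
split=> [|x y]; rewrite !unfold_in ?raddf0 //.
by move=> /eqP gx /eqP gy; rewrite raddfB gx gy subrr.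
Qed.
HB.instance Definition _ :=
  GRing.isZmodClosed.Build B cycle_pred cycle_zmod_closed.

Record cycles := Cycle { cycle_val : B; _ : cycle_val \in cycle_pred }.
HB.instance Definition _ := [isSub for cycle_val].
HB.instance Definition _ := [Choice of cycles by <:].
HB.instance Definition _ := [SubChoice_isSubZmodule of cycles by <:].

Definition boundary_pred : {pred cycles} :=
  fun z => `[< exists c : A, f c = val z >].

Fact boundary_zmod_closed : zmod_closed boundary_pred.
Proof.
split=> [|x y]; rewrite !unfold_in; first by apply/asboolP; exists 0; rewrite !raddf0.
move=> /asboolP[a fa] /asboolP[b fb]; apply/asboolP; exists (a - b).
by rewrite !raddfB fa fb.
Qed.
HB.instance Definition _ :=
  GRing.isZmodClosed.Build cycles boundary_pred boundary_zmod_closed.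

Definition homology_at : zmodType := Quotient.quot boundary_pred.

Lemma Zfree_homology_at n (s : 'I_n -> homology_at) :
  Zfree s -> exists s' : 'I_n -> B, Zfree s'.
Proof.
pose Q := Quotient.quot boundary_pred; pose r (x : Q) := generic_quotient.repr x.
move=> s_free; exists (fun i => val (r (s i))) => c sum0; apply: s_free.
have /(congr1 (\pi_Q)%qT) : \sum_i r (s i) *~ c i = 0.
  by apply: val_inj; rewrite raddf_sum -[RHS]sum0; apply: eq_bigr => i _; rewrite raddfMz.
rewrite raddf_sum raddf0 => E; rewrite -[RHS]E; apply: eq_bigr => i _.
by rewrite raddfMz /= /r reprK.
Qed.

End HomologyAt.

Section OrderComplex.
Variables (d : Order.disp_t) (T : finPOrderType d) (P : {set T}).

Definition is_chain k (s : {ffun 'I_k -> T}) : bool :=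
  [forall i, s i \in P] && [forall i : 'I_k, forall j : 'I_k, (i < j)%N ==> (s i < s j)%O].

(* Chains with k elements, listed in increasing order: for k = m.+1 these are
   the m-simplices of the order complex of P, for k = 0 it is the empty chain,
   which spans degree -1 of the augmented complex. *)
Record simplex k := Simplex { vertices :> {ffun 'I_k -> T}; _ : is_chain vertices }.
HB.instance Definition _ k := [isSub for @vertices k].
HB.instance Definition _ k := [Finite of simplex k by <:].

Definition chains k : Type := {ffun simplex k -> int}.
HB.instance Definition _ k := GRing.Zmodule.on (chains k).

Fact face_subproof k (s : simplex k.+1) (i : 'I_k.+1) :
  is_chain [ffun j => s (lift i j)].
Proof.
case: s => s /= /andP[/forallP sP /forallP s_lt]; apply/andP; split.
  by apply/forallP=> j; rewrite ffunE.
apply/forallP=> j; apply/forallP=> l; apply/implyP=> lt_jl; rewrite !ffunE.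
by move/implyP: (forallP (s_lt (lift i j)) (lift i l)); apply; rewrite /= /bump; lia.
Qed.
Definition face k (s : simplex k.+1) (i : 'I_k.+1) : simplex k :=
  Sub _ (face_subproof s i).

(* The boundary is d s = \sum_i (-1)^i (face s i) on simplices; on vertices
   (k = 0) it is the augmentation. *)
Definition bd k (c : chains k.+1) : chains k :=
  [ffun t => \sum_s \sum_(i < k.+1 | face s i == t) (-1) ^+ i * c s].

Fact bd_is_zmod_morphism k : zmod_morphism (@bd k).
Proof.
move=> a b; apply/ffunP=> t; rewrite !ffunE -sumrB; apply: eq_bigr => s _.
by rewrite -sumrB; apply: eq_bigr => i _; rewrite !ffunE mulrBr.
Qed.
HB.instance Definition _ k :=
  GRing.isZmodMorphism.Build (chains k.+1) (chains k) (@bd k)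
    (@bd_is_zmod_morphism k).

Fact face_face k (s : simplex k.+2) (i i' : 'I_k.+2) (j j' : 'I_k.+1) :
  i' = lift i j -> i = lift i' j' -> face (face s i) j = face (face s i') j'.
Proof.
move=> /(congr1 val) /= Ei' /(congr1 val) /= Ei.
apply/val_inj/ffunP=> l /=; rewrite !ffunE; congr (vertices s _).
by apply/val_inj => /=; move: Ei' Ei; rewrite /bump; lia.
Qed.

Lemma bd_bd k (c : chains k.+2) : bd (bd c) = 0.
Proof.
apply/ffunP=> t; rewrite !ffunE.
pose F (u : simplex k.+2) (p : 'I_k.+2 * 'I_k.+1) : int :=
  if face (face u p.1) p.2 == t then (-1) ^+ (p.1 + p.2) * c u else 0.
transitivity (\sum_u \sum_p F u p).
  pose g s := \sum_(j < k.+1 | face s j == t) (-1) ^+ j : int.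
  transitivity (\sum_s \sum_u \sum_(i < k.+2 | face u i == s)
                  g s * ((-1) ^+ i * c u)).
    apply: eq_bigr => s _; rewrite -mulr_suml -/(g s) ffunE mulr_sumr.
    by apply: eq_bigr => u _; rewrite mulr_sumr.
  rewrite exchange_big /=; apply: eq_bigr => u _.
  rewrite (exchange_big_dep predT) //=.
  transitivity (\sum_(i < k.+2) \sum_(j < k.+1) F u (i, j)).
    apply: eq_bigr => i _; rewrite (big_pred1 (face u i)) => [|s]; last exact: eq_sym.
    rewrite mulr_suml big_mkcond; apply: eq_bigr => j _; rewrite /F /=.
    by case: ifP => // _; rewrite mulrA -exprD addnC.
  by rewrite pair_bigA; apply: eq_bigr => -[].
apply: big1 => u _.
have swap_lt (p : 'I_k.+2 * 'I_k.+1) : ((if p.2 < p.1 then p.1.-1 else p.1) < k.+1)%N.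
  by case: p => -[i ?] [j ?] /=; case: (ltnP j i) => ?; lia.
pose swap p := (lift p.1 p.2, Ordinal (swap_lt p)).
have swapK : involutive swap.
  move=> [[i ?] [j ?]]; congr pair; apply/val_inj; rewrite /= /bump /=;
    by case: (ltnP j i) => ? /=; try case: ifP => ?; lia.
have Fswap p : F u (swap p) = - F u p.
  rewrite /F (@face_face _ u (swap p).1 p.1 (swap p).2 p.2) //; last first.
    by rewrite -[p in LHS]swapK.
  case: ifP => _; last by rewrite oppr0.
  rewrite -mulNr; congr (_ * _); rewrite -[RHS]mulN1r -exprS.
  rewrite -signr_odd -[RHS]signr_odd; congr (_ ^+ nat_of_bool _).
  by case: p => -[i ?] [j ?] /=; rewrite /bump; case: (ltnP j i) => ? /=; lia.
have: \sum_p F u p = - \sum_p F u p.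
  rewrite {1}(reindex_inj (inv_inj swapK)) /= -sumrN.
  by apply: eq_bigr => p _; rewrite Fswap.
lia.
Qed.

Definition homology (m : nat) : zmodType :=
  if m is m'.+1 then homology_at (@bd m'.+2) (@bd m'.+1)
  else homology_at (@bd 1) (\0 : {additive chains 1 -> chains 0}).

Definition reduced_homology (m : int) : zmodType :=
  match m with
  | Posz n => homology_at (@bd n.+1) (@bd n)
  | Negz 0 => homology_at (@bd 0) (\0 : {additive chains 0 -> chains 0})
  | Negz _.+1 => 'rV[int]_0
  end.

Lemma is_tfrank_homology m : is_tfrank (homology m) (tfrank (homology m)).
Proof.
apply: (@tfrankP (homology m) #|{: simplex m.+1}|) => n s s_free.
by case: m s s_free => [|m] s /Zfree_homology_at[s' /Zfree_ffun].
Qed.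

Lemma is_tfrank_reduced_homology m :
  is_tfrank (reduced_homology m) (tfrank (reduced_homology m)).
Proof.
case: m => [m|[|m]].
- by apply: (@tfrankP (reduced_homology (Posz m)) #|{: simplex m.+1}|) => n s /Zfree_homology_at[s' /Zfree_ffun].
- by apply: (@tfrankP (reduced_homology (Negz 0)) #|{: simplex 0}|) => n s /Zfree_homology_at[s' /Zfree_ffun].
- apply: (@tfrankP 'rV[int]_0 0) => -[//|n] s /(_ (fun=> 1)) s_free.
  suff /s_free/(_ ord0)/eqP : \sum_i s i *~ 1 = 0 by [].
  by apply/rowP=> -[].
Qed.

End OrderComplex.

(* Posets of subsets of gT; the inclusion order on {set gT} is the one declared
   by Order.DefaultSetSubsetOrder. *)
Section GroupPosets.
Variables (gT : finGroupType) (G : {set gT}).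
Local Open Scope group_scope.

Definition LG : {set {set gT}} :=
  [set gval K | K : {group gT} & (1%G \proper K) && (K \proper G)].

Definition CG : {set {set gT}} :=
  \bigcup_(K : {group gT} | K \proper G) lcosets K G.

Definition SG : {set {set gT}} := CG :\: [set [set g] | g in G].

End GroupPosets.

(* Main.v *)
From HB Require Import structures.
Require Import Defs.
From mathcomp Require Import all_boot all_order all_algebra all_fingroup.
From mathcomp Require Import boolp.
From mathcomp Require Import zify.

Set Implicit Arguments.
Unset Strict Implicit.
Unset Printing Implicit Defensive.

Import Order.DefaultSetSubsetOrder.
Import Order.TTheory GRing.Theory Num.Theory.
Local Open Scope ring_scope.

(** All three inequalities are instances of one bound, valid for every finite
    poset P (tfrank_homology_poset):
      dim H_m(P) <= \sum_(x in P) dim rH_(m-1)(P_<x),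
    where rH is reduced homology and P_<x is the set of the elements of P that
    lie strictly below x.

    The bound is proved by removing one maximal element x at a time.  Since x is
    maximal, the simplices of the order complex of P that contain x are the
    point x and the cones with apex x over the simplices of P_<x, so that the
    relative homology of (P, P \ x) is the reduced homology of P_<x shifted by one, and the exact
    sequence of the pair contains
      H_m(P \ x) -> H_m(P) -> rH_(m-1)(P_<x).
    Exactness in the middle and subadditivity of the rank give the term of x
    (tfrank_homology_maximal); as x is maximal, removing it does not change P_<y
    for the other y, so the induction continues.

    On chains the second map has a concrete description: keep the coefficients
    of the simplices with last vertex x, and drop this vertex.  As x is in the
    last position, every sign in the boundary is unaffected (pull_cone_bd), and
    this map is therefore a chain map without any correction.  Subadditivity of
    the rank is applied directly to cycles modulo boundaries
    (tfrank_homology_exact), and rests on the fact that n elements of an abelian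
    group of rank r satisfy at least n - r independent integral relations
    (Zfree_relations).

    For the poset of subgroups, the elements below K are the nontrivial proper
    subgroups of K.  For cosets, translation by g^-1 maps the elements below gK
    isomorphically to the coset poset of K, and each K has #|G : K| cosets. *)

(** * Integral relations and the torsion-free rank *)

Section FreeRank.
Variable A : zmodType.
Implicit Types (r n p : nat).

Definition free_on n (s : 'I_n -> A) (J : {set 'I_n}) : Prop :=
  forall c : 'I_n -> int, \sum_(i in J) s i *~ c i = 0 -> {in J, forall i, c i = 0}.

Lemma free_on_card r n (s : 'I_n -> A) (J : {set 'I_n}) :
  is_tfrank A r -> free_on s J -> (#|J| <= r)%N.
Proof.
case=> _ r_max sJ; apply: (r_max _ (s \o @enum_val _ (mem J))) => c c0 i.
pose e k := c (enum_rank_in (enum_valP i) k).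
have eE k : e (enum_val k) = c k by rewrite /e enum_valK_in.
rewrite -eE; apply: sJ (enum_valP i); rewrite big_enum_val -[RHS]c0.
by apply: eq_bigr => k _; rewrite eE.
Qed.

(** The integral form of rank-nullity.  Take a maximal J on which s is free: J
    has at most r elements, and for i outside J maximality yields a relation
    supported on J and i in which s i has a nonzero coefficient.  The relations
    obtained for different i are independent, because each of the indices i
    occurs in only one of them. *)
Lemma Zfree_relations r n (s : 'I_n -> A) : is_tfrank A r ->
  exists p (rel : 'I_p -> {ffun 'I_n -> int}),
    [/\ (n <= p + r)%N, Zfree rel & forall j, \sum_i s i *~ rel j i = 0].
Proof.
move=> rk; pose fr (J : {set 'I_n}) := `[< free_on s J >].
have fr0 : fr set0 by apply/asboolP => c _ i; rewrite inE.
have [J /maxsetP[/asboolP sJ Jmax] _] := maxset_exists fr0.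
have relP (i : 'I_n) : i \notin J -> exists c : {ffun 'I_n -> int},
    [/\ c i != 0, forall k, k \notin i |: J -> c k = 0 & \sum_k s k *~ c k = 0].
  move=> iJ; have : ~ free_on s (i |: J).
    move=> /asboolP /Jmax /(_ (subsetUr _ _)) E.
    by move: iJ; rewrite -E setU11.
  move=> /existsNP[c /not_implyP[c0 cN]].
  have ci : c i != 0.
    apply/eqP => ci; apply: cN => k; rewrite !inE => /orP[/eqP->//|].
    by apply: sJ; rewrite big_setU1 //= ci mulr0z add0r in c0.
  exists [ffun k => if k \in i |: J then c k else 0]; split.
  - by rewrite ffunE setU11.
  - by move=> k /negPf kN; rewrite ffunE kN.
  rewrite -[RHS]c0 [RHS]big_mkcond /=; apply: eq_bigr => k _; rewrite ffunE.
  by case: ifP; rewrite ?mulr0z.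
have notJ (j : 'I_#|~: J|) : enum_val j \notin J.
  by have := enum_valP j; rewrite inE.
have /choice[rel relE] (j : 'I_#|~: J|) := relP _ (notJ j).
exists #|~: J|, rel; split; last by move=> j; case: (relE j).
  rewrite -[n in (n <= _)%N]card_ord -(cardsC J) addnC leq_add2l.
  exact: free_on_card rk sJ.
move=> e e0 j; have /ffunP/(_ (enum_val j)) := e0.
rewrite sum_ffunE ffunE (bigD1 j) //= big1 ?addr0 => [|k kj].
  rewrite ffunMzE mulrzz => /eqP; rewrite mulf_eq0 => /orP[|/eqP//].
  by case: (relE j) => /negPf->.
rewrite ffunMzE mulrzz; case: (relE k) => _ -> //; first by rewrite mul0r.
by rewrite !inE (inj_eq enum_val_inj) eq_sym negb_or kj notJ.
Qed.

End FreeRank.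

(** * Independent cycles modulo boundaries *)

Section HomologyRank.
Variables (A B C : zmodType) (f : {additive A -> B}) (g : {additive B -> C}).

(** Zfree families of homology classes, on the level of representatives: this
    makes it possible to compare homology groups through maps of chains, without
    constructing the induced maps between the quotients. *)
Definition free_cycles n (s : 'I_n -> B) : Prop :=
  (forall i, g (s i) = 0) /\
  (forall (c : 'I_n -> int) a, f a = \sum_i s i *~ c i -> forall i, c i = 0).

Local Notation H := (homology_at f g).
Let Q := Quotient.quot (boundary_pred f (g := g)).

Lemma pi_eq0 (z : cycles g) :
  (\pi_Q z = 0 :> Q)%qT <-> exists a, f a = val z.
Proof.
rewrite -[0 in X in X <-> _](raddf0 \pi_Q%qT); split=> [/eqP|].
  by rewrite -Quotient.idealrBE subr0 => /asboolP.
by move=> za; apply/eqP; rewrite -Quotient.idealrBE subr0; apply/asboolP.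
Qed.

Lemma Zfree_free_cycles n (s : 'I_n -> H) :
  Zfree s -> exists s' : 'I_n -> cycles g, free_cycles (val \o s').
Proof.
move=> s_free; pose s' (i : 'I_n) := generic_quotient.repr (s i : Q).
exists s'; split=> [i|c a fa]; first exact/eqP/(valP (s' i)).
apply: s_free; transitivity (\pi_Q (\sum_i s' i *~ c i) : Q)%qT.
  by rewrite raddf_sum; apply: eq_bigr => i _; rewrite raddfMz /= /s' reprK.
by apply/pi_eq0; exists a; rewrite fa raddf_sum; apply: eq_bigr => i _; rewrite raddfMz.
Qed.

End HomologyRank.

Section ExactRank.
Variables (A B C A' B' C' : zmodType).
Variables (f : {additive A -> B}) (g : {additive B -> C}).
Variables (f' : {additive A' -> B'}) (g' : {additive B' -> C'}).
Variable (i : {additive B' -> B}).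
Hypothesis i_bd : forall a', exists a, f a = i (f' a').

Local Notation H := (homology_at f g).
Local Notation H' := (homology_at f' g').

Lemma free_cycles_Zfree n (s : 'I_n -> B') :
  free_cycles f' g' s -> exists s' : 'I_n -> H', Zfree s'.
Proof.
move=> [s_cyc s_free]; pose Q := Quotient.quot (boundary_pred f' (g := g')).
pose z k : cycles g' := Sub (s k) (introT eqP (s_cyc k)).
exists (fun k => \pi_Q (z k))%qT => c sum0.
have /pi_eq0[a fa] : (\pi_Q (\sum_k z k *~ c k) = 0 :> Q)%qT.
  by rewrite -[RHS]sum0 raddf_sum; apply: eq_bigr => k _; rewrite raddfMz.
apply: (s_free c a); rewrite fa raddf_sum.
by apply: eq_bigr => k _; rewrite raddfMz.
Qed.

Lemma free_cycles_lift n (s : 'I_n -> B) : free_cycles f g s ->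
    (forall k, exists z' a, g' z' = 0 /\ s k = i z' + f a) ->
  exists s' : 'I_n -> H', Zfree s'.
Proof.
move=> [_ s_free] /choice[z' /choice[a zaP]]; apply: (@free_cycles_Zfree _ z').
split=> [k|c a' fa']; first by case: (zaP k).
have [b fb] := i_bd a'.
apply: (s_free c (b + \sum_k a k *~ c k)); rewrite raddfD fb fa'.
rewrite !raddf_sum -big_split /=.
by apply: eq_bigr => k _; rewrite !raddfMz -mulrzDl; case: (zaP k) => _ <-.
Qed.

Lemma tfrank_homology_onto r r' : is_tfrank H r -> is_tfrank H' r' ->
    (forall z, g z = 0 -> exists z' a, g' z' = 0 /\ z = i z' + f a) ->
  (r <= r')%N.
Proof.
move=> [[s /Zfree_free_cycles[z z_free]] _] [_ r'_max] onto.
have [k|s' /r'_max//] := free_cycles_lift z_free.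
by apply: onto; case: z_free.
Qed.

Variables (A'' B'' C'' : zmodType).
Variables (f'' : {additive A'' -> B''}) (g'' : {additive B'' -> C''}).
Variable (h : {additive B -> B''}).
Local Notation H'' := (homology_at f'' g'').

(** Subadditivity of the rank for a sequence H' -> H -> H'' that is exact in the
    middle.  If the rank of H'' is r'', independent classes of H admit enough
    combinations that vanish in H''; by exactness these come from H', where they
    are still independent. *)
Lemma tfrank_homology_exact r r' r'' :
    is_tfrank H r -> is_tfrank H' r' -> is_tfrank H'' r'' ->
    (forall z, g z = 0 -> g'' (h z) = 0) ->
    (forall z a'', g z = 0 -> h z = f'' a'' ->
       exists z' a, g' z' = 0 /\ z = i z' + f a) ->
  (r <= r' + r'')%N.
Proof.
move=> [[s /Zfree_free_cycles[z z_free]] _] [_ r'_max] rk'' h_cyc exact_B.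
pose Q := Quotient.quot (boundary_pred f'' (g := g'')).
have z_cyc k : g (val (z k)) = 0 by apply/eqP/(valP (z k)).
have hz_cyc k : h (val (z k)) \in cycle_pred g'' by apply/eqP/h_cyc.
pose hz k : cycles g'' := Sub (h (val (z k))) (hz_cyc k).
have [p [rel [le_p rel_free rel0]]] :=
  Zfree_relations (fun k => \pi_Q (hz k) : Q)%qT rk''.
pose u j := \sum_k val (z k) *~ rel j k.
have u_cyc j : g (u j) = 0.
  by rewrite raddf_sum big1 // => k _; rewrite raddfMz /= z_cyc mul0rz.
suff /free_cycles_lift : free_cycles f g u.
  case=> [j|s' /r'_max le_r']; last by rewrite (leq_trans le_p) ?leq_add2r.
  have /pi_eq0[a'' fa''] : (\pi_Q (\sum_k hz k *~ rel j k) = 0 :> Q)%qT.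
    rewrite -[RHS](rel0 j) raddf_sum; apply: eq_bigr => k _; rewrite raddfMz.
    by [].
  apply: (exact_B _ a''); first exact: u_cyc.
  by rewrite fa'' /u !raddf_sum; apply: eq_bigr => k _; rewrite !raddfMz.
split=> // e a fa.
apply: rel_free; apply/ffunP => k; rewrite ffunE; move: k; apply: (z_free.2 _ a).
rewrite fa /u; under eq_bigr do rewrite mulrz_suml.
rewrite exchange_big; apply: eq_bigr => k _ /=; rewrite sum_ffunE mulrz_sumr.
by apply: eq_bigr => j _; rewrite ffunMzE mulrzz mulrzA.
Qed.

End ExactRank.

(** * Transport of chains along maps of simplices *)

Section PushPull.
Variables (I J : finType) (h : I -> J).

Definition push (c : {ffun I -> int}) : {ffun J -> int} :=
  [ffun j => \sum_(i | h i == j) c i].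
Definition pull (c : {ffun J -> int}) : {ffun I -> int} := [ffun i => c (h i)].

Fact push_is_zmod_morphism : zmod_morphism push.
Proof.
move=> a b; apply/ffunP=> j; rewrite !ffunE -sumrB.
by apply: eq_bigr => i _; rewrite !ffunE.
Qed.
HB.instance Definition _ :=
  GRing.isZmodMorphism.Build {ffun I -> int} {ffun J -> int} push push_is_zmod_morphism.

Fact pull_is_zmod_morphism : zmod_morphism pull.
Proof. by move=> a b; apply/ffunP=> i; rewrite !ffunE. Qed.
HB.instance Definition _ :=
  GRing.isZmodMorphism.Build {ffun J -> int} {ffun I -> int} pull pull_is_zmod_morphism.

Lemma pushK : injective h -> cancel push pull.
Proof.
by move=> h_inj c; apply/ffunP=> i; rewrite !ffunE (big_pred1 i) // => k; apply: inj_eq.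
Qed.

Lemma pullK (c : {ffun J -> int}) :
    injective h -> (forall j, c j != 0 -> exists i, j = h i) ->
  push (pull c) = c.
Proof.
move=> h_inj supp_c; apply/ffunP=> j; rewrite ffunE.
have [c0|/supp_c[i ->]] := eqVneq (c j) 0.
  by rewrite c0 big1 // => i /eqP ij; rewrite ffunE ij.
by rewrite (big_pred1 i) => [|k]; rewrite ?ffunE // inj_eq.
Qed.

End PushPull.

Section SimplicialMap.
Variables (d d' : Order.disp_t) (T : finPOrderType d) (T' : finPOrderType d').
Variables (P : {set T}) (Q : {set T'}) (phi : T -> T').
Hypothesis phiPQ : {in P, forall x, phi x \in Q}.
Hypothesis phi_lt : {in P &, {homo phi : x y / (x < y)%O}}.

Lemma simplexP k (s : simplex P k) :
  (forall i, s i \in P) /\ (forall i j : 'I_k, (i < j)%N -> (s i < s j)%O).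
Proof.
case: s => s /= /andP[/forallP sP /forallP s_lt]; split=> // i j lt_ij.
by have /forallP/(_ j)/implyP/(_ lt_ij) := s_lt i.
Qed.

Fact map_simplex_subproof k (s : simplex P k) : is_chain Q [ffun i => phi (s i)].
Proof.
have [sP s_lt] := simplexP s; apply/andP; split; apply/forallP=> i.
  by rewrite ffunE phiPQ.
by apply/forallP=> j; apply/implyP=> lt_ij; rewrite !ffunE phi_lt ?s_lt.
Qed.
Definition map_simplex k (s : simplex P k) : simplex Q k :=
  Sub _ (map_simplex_subproof s).

Lemma face_map k (s : simplex P k.+1) i :
  face (map_simplex s) i = map_simplex (face s i).
Proof. by apply/val_inj/ffunP=> j; rewrite /= !ffunE. Qed.

(** Functoriality of the simplicial chain complex.  Strict monotonicity of phi
    means that no simplex collapses, so faces map to faces with the same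
    index. *)
Lemma bd_push k (c : chains P k.+1) :
  bd (push (@map_simplex k.+1) c : chains Q k.+1) = push (@map_simplex k) (bd c).
Proof.
apply/ffunP=> u; rewrite !ffunE.
transitivity (\sum_(t : simplex P k.+1)
    \sum_(i < k.+1 | map_simplex (face t i) == u) (-1) ^+ i * c t).
  transitivity (\sum_(s : simplex Q k.+1) \sum_(t | map_simplex t == s)
      \sum_(i < k.+1 | map_simplex (face t i) == u) (-1) ^+ i * c t).
    apply: eq_bigr => s _; under eq_bigr do rewrite ffunE mulr_sumr.
    rewrite exchange_big; apply: eq_bigr => t /eqP ts; apply: eq_bigl => i.
    by rewrite -face_map ts.
  rewrite (exchange_big_dep predT) //=; apply: eq_bigr => t _.
  by rewrite (big_pred1 (map_simplex t)) // => s; apply: eq_sym.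
rewrite (eq_bigr (fun v => \sum_t \sum_(i < k.+1 | face t i == v) (-1) ^+ i * c t));
  last first.
  by move=> v _; rewrite ffunE.
rewrite exchange_big; apply: eq_bigr => t _ /=.
rewrite (exchange_big_dep (fun i => map_simplex (face t i) == u)) /=; last first.
  by move=> v i vu /eqP->.
apply: eq_bigr => i iu; rewrite (big_pred1 (face t i)) // => v.
by rewrite /= andbC eq_sym; case: eqP => [->|].
Qed.

Lemma map_simplex_inj k : {in P &, injective phi} -> injective (@map_simplex k).
Proof.
move=> phi_inj s t /(congr1 val) /ffunP E; apply/val_inj/ffunP => i.
have [sP _] := simplexP s; have [tP _] := simplexP t.
by apply: phi_inj => //; have := E i; rewrite !ffunE.
Qed.

End SimplicialMap.

(** * Removing a maximal element *)

Definition strictly_below (d : Order.disp_t) (T : finPOrderType d)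
    (P : {set T}) (x : T) : {set T} :=
  [set y in P | (y < x)%O].

Section MaximalVertex.
Variables (d : Order.disp_t) (T : finPOrderType d) (P : {set T}) (x : T).
Hypotheses (xP : x \in P) (x_max : {in P, forall y, ~~ (x < y)%O}).
Local Notation R := (strictly_below P x).
Local Notation Q := (P :\ x).

Fact cone_subproof k (u : simplex R k) :
  is_chain P [ffun j : 'I_k.+1 => if unlift ord_max j is Some i then u i else x].
Proof.
have [uR u_lt] := simplexP u; apply/andP; split; apply/forallP=> i.
  by rewrite ffunE; case: unliftP => // l _; have := uR l; rewrite inE => /andP[].
apply/forallP=> j; apply/implyP; rewrite !ffunE.
case: (unliftP _ i) => [i' ->|->]; case: (unliftP _ j) => [j' ->|->];
  last by rewrite ltnn.
- by rewrite !lift_max; apply: u_lt.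
- by have := uR i'; rewrite inE => /andP[].
- by rewrite lift_max ltnNge ltnW /=.
Qed.
Definition cone k (u : simplex R k) : simplex P k.+1 := Sub _ (cone_subproof u).

Lemma cone_max k (u : simplex R k) : cone u ord_max = x.
Proof. by rewrite ffunE unlift_none. Qed.

Lemma cone_lift k (u : simplex R k) i : cone u (lift ord_max i) = u i.
Proof. by rewrite ffunE liftK. Qed.

Lemma cone_inj k : injective (@cone k).
Proof.
move=> u v E; apply/val_inj/ffunP => i.
by rewrite -!cone_lift E.
Qed.

Lemma face_cone k (u : simplex R k.+1) i :
  face (cone u) (lift ord_max i) = cone (face u i).
Proof.
apply/val_inj/ffunP => j; rewrite ffunE.
case: (unliftP ord_max j) => [j' ->|->]; last first.
  rewrite cone_max (_ : lift _ _ = ord_max) ?cone_max //.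
  by apply/val_inj => /=; rewrite /bump; have := ltn_ord i => /=; lia.
rewrite cone_lift (_ : lift _ _ = lift ord_max (lift i j')) ?cone_lift ?ffunE //.
apply/val_inj => /=; rewrite /bump.
by have := ltn_ord i => /=; have := ltn_ord j' => /=; lia.
Qed.

Lemma coneP k (s : simplex P k.+1) : s ord_max = x -> exists u, s = cone u.
Proof.
move=> sx; have [sP s_lt] := simplexP s.
have uP : is_chain R [ffun i => s (lift ord_max i)].
  apply/andP; split; apply/forallP => i.
    by rewrite ffunE inE sP -sx s_lt // lift_max ltn_ord.
  apply/forallP => j; apply/implyP => lt_ij; rewrite !ffunE s_lt //.
  by rewrite !lift_max.
exists (Sub _ uP); apply/val_inj/ffunP => j.
case: (unliftP ord_max j) => [j' ->|->]; last by rewrite cone_max.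
by rewrite cone_lift /= ffunE.
Qed.

Lemma simplex_max k (s : simplex P k.+1) i : s i = x -> i = ord_max.
Proof.
move=> si; have [sP s_lt] := simplexP s; apply/eqP; apply/contraT => i_max.
have := x_max (sP ord_max); rewrite -si s_lt //=.
by rewrite ltn_neqAle -ltnS ltn_ord andbT.
Qed.

(** A face of s is a cone with apex x only if s is itself a cone and the vertex
    removed is not x: removing x from a cone leaves no x, and if x appeared only
    after removing the last vertex of s, that vertex would lie above x. *)
Lemma pull_cone_bd k (c : chains P k.+2) :
  pull (@cone k) (bd c) = bd (pull (@cone k.+1) c : chains R k.+1).
Proof.
apply/ffunP => t; rewrite !ffunE.
rewrite (bigID (fun s : simplex P k.+2 => s \in @cone k.+1 @: setT)) /= addrC big1 ?add0r.
  rewrite (big_imset (h := @cone k.+1)) /=; last by move=> u v _ _; apply: cone_inj.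
  under eq_bigl do rewrite inE; apply: eq_bigr => u _; rewrite ffunE.
  (* The last index removes the apex. *)
  rewrite big_mkcond big_ord_recr /= [X in _ + X]ifN ?addr0; last first.
    apply/eqP => /(congr1 (fun s : simplex P k.+1 => s ord_max)).
    rewrite cone_max /= ffunE cone_lift => E.
    have [/(_ ord_max)] := simplexP u; rewrite E inE ltxx andbF //.
  rewrite [RHS]big_mkcond; apply: eq_bigr => i _.
  have -> : widen_ord (leqnSn k.+1) i = lift ord_max i.
    exact/val_inj/esym/lift_max.
  by rewrite face_cone (inj_eq (@cone_inj k)).
move=> s /negP s_cone; rewrite big_pred0 // => i; apply/negbTE/eqP => E; case: s_cone.
apply/imsetP; suff /coneP[u ->] : s ord_max = x by exists u.
have /simplex_max si : s (lift i ord_max) = x by rewrite -(cone_max t) -E /= ffunE.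
by rewrite -si -(cone_max t) -E /= ffunE.
Qed.

Let QP : {in Q, forall y, id y \in P}. Proof. by move=> y /setD1P[]. Qed.
Let Q_lt : {in Q &, {homo id : y z / (y < z)%O}}. Proof. by []. Qed.
Local Notation incl := (map_simplex QP Q_lt).

(** Exactness on chains: since x can only be the last vertex of a simplex, a
    chain killed by pull cone is supported on the simplices that avoid x. *)
Lemma push_inclK k (c : chains P k.+1) : pull (@cone k) c = 0 ->
  push (@incl k.+1) (pull (@incl k.+1) c) = c.
Proof.
move=> c0; apply: pullK => [|s cs]; first by apply: map_simplex_inj.
have [sP s_lt] := simplexP s.
have sQ : is_chain Q s.
  apply/andP; split; apply/forallP => i; last first.
    by apply/forallP => j; apply/implyP => /s_lt.
  rewrite !inE sP andbT; apply/eqP => si; case/eqP: cs.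
  have /coneP[u ->] : s ord_max = x by rewrite -(simplex_max si).
  by have /ffunP/(_ u) := c0; rewrite !ffunE.
by exists (Sub _ sQ); apply/val_inj/ffunP => i; rewrite /= ffunE.
Qed.

(** If the image of a cycle z bounds w in P_<x, then subtracting from z the
    boundary of the cone over w gives a homologous cycle whose image is zero,
    that is, a cycle of P \ x. *)
Lemma tfrank_homology_maximal m :
  (tfrank (homology P m) <=
     tfrank (homology Q m) + tfrank (reduced_homology R (m%:Z - 1)))%N.
Proof.
case: m => [|m].
  apply: (tfrank_homology_exact (i := push (@incl 1)) (h := pull (@cone 0)) _
    (is_tfrank_homology P 0) (is_tfrank_homology Q 0)
    (is_tfrank_reduced_homology R (- 1))) => //.
    by move=> a; exists (push (@incl 2) a); apply: bd_push.
  move=> z w z_cyc /= hz.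
  exists (pull (@incl 1) (z - bd (push (@cone 1) w))), (push (@cone 1) w).
  split=> //=; rewrite push_inclK ?subrK // raddfB /= hz pull_cone_bd pushK ?subrr //.
  exact: cone_inj.
have -> : m.+1%:Z - 1 = m by lia.
apply: (tfrank_homology_exact (i := push (@incl m.+2)) (h := pull (@cone m.+1)) _
    (is_tfrank_homology P m.+1) (is_tfrank_homology Q m.+1)
    (is_tfrank_reduced_homology R m)).
- by move=> a; exists (push (@incl m.+3) a); apply: bd_push.
- by move=> z z_cyc /=; rewrite -pull_cone_bd z_cyc raddf0.
move=> z w z_cyc /= hz; pose a := push (@cone m.+2) w.
have za : push (@incl m.+2) (pull (@incl m.+2) (z - bd a)) = z - bd a.
  by rewrite push_inclK // raddfB /= hz pull_cone_bd pushK ?subrr //; apply: cone_inj.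
exists (pull (@incl m.+2) (z - bd a)), a; split; last by rewrite za subrK.
apply: (can_inj (pushK (@map_simplex_inj _ _ _ _ _ _ _ QP Q_lt m.+1 _))) => //.
by rewrite -bd_push za raddf0 raddfB z_cyc /= bd_bd subr0.
Qed.

End MaximalVertex.

(** * The rank bound for finite posets *)

Lemma tfrank_homology0 (d : Order.disp_t) (T : finPOrderType d) m :
  tfrank (homology (set0 : {set T}) m) = 0%N.
Proof.
have card0 : #|{: simplex (set0 : {set T}) m.+1}| = 0%N.
  apply/eqP; rewrite -leqn0 leqNgt; apply/card_gt0P => -[s _].
  by have [/(_ ord0)] := simplexP s; rewrite inE.
have [[s s_free] _] := is_tfrank_homology (set0 : {set T}) m; apply/eqP.
rewrite -leqn0 -card0; move: (tfrank _) s s_free => r.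
by case: m {card0} => [|m] s /Zfree_homology_at[s' /Zfree_ffun].
Qed.

Lemma maximal_elementP (d : Order.disp_t) (T : finPOrderType d) (P : {set T}) :
  P != set0 -> exists2 x, x \in P & {in P, forall y, ~~ (x < y)%O}.
Proof.
case/set0Pn => x0 Px0; have [x Px x_max] :=
  arg_maxnP (fun x => #|strictly_below P x|) Px0.
exists x => // y Py; apply/negP => lt_xy; have /= := x_max y Py; apply/negP.
rewrite -ltnNge; apply/proper_card/properP; split; last first.
  by exists x; rewrite !inE ?ltxx ?andbF //; apply/andP.
by apply/subsetP => z; rewrite !inE => /andP[-> /lt_trans->].
Qed.

Theorem tfrank_homology_poset (d : Order.disp_t) (T : finPOrderType d) (P : {set T}) m :
  (tfrank (homology P m) <=
     \sum_(x in P) tfrank (reduced_homology (strictly_below P x) (m%:Z - 1)))%N.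
Proof.
have [n] := ubnP #|P|; elim: n P => // n IH P le_Pn.
have [->|/maximal_elementP[x Px x_max]] := eqVneq P set0.
  by rewrite tfrank_homology0.
apply: leq_trans (tfrank_homology_maximal Px x_max m) _.
rewrite (big_setD1 x) //= addnC leq_add2l.
apply: leq_trans (IH (P :\ x) _) _; first by move: le_Pn; rewrite (cardsD1 x) Px.
apply/eq_leq/eq_bigr => y /setD1P[_ Py]; congr (tfrank (reduced_homology _ _)).
apply/setP => z; rewrite !inE; case: eqVneq => //= ->.
by rewrite (negPf (x_max y Py)) andbF.
Qed.

(** * Invariance under isomorphism *)

Section PosetIso.
Variables (d d' : Order.disp_t) (T : finPOrderType d) (T' : finPOrderType d').
Variables (P : {set T}) (Q : {set T'}) (phi : T -> T') (psi : T' -> T).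
Hypothesis (phiPQ : {in P, forall x, phi x \in Q}).
Hypothesis (psiQP : {in Q, forall y, psi y \in P}).
Hypothesis phi_lt : {in P &, {homo phi : x y / (x < y)%O}}.
Hypothesis psi_lt : {in Q &, {homo psi : x y / (x < y)%O}}.
Hypotheses (phiK : {in P, cancel phi psi}) (psiK : {in Q, cancel psi phi}).

Local Notation phi_s := (map_simplex phiPQ phi_lt).

Let phi_s_inj k : injective (@phi_s k).
Proof. by apply: map_simplex_inj; apply: can_in_inj phiK. Qed.

Let push_phiK k (c : chains Q k) : push (@phi_s k) (pull (@phi_s k) c) = c.
Proof.
apply: pullK => [|s _]; first exact: phi_s_inj.
exists (map_simplex psiQP psi_lt s).
have [sQ _] := simplexP s.
by apply/val_inj/ffunP => i; rewrite /= !ffunE psiK.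
Qed.

Lemma tfrank_reduced_homology_iso m :
  (tfrank (reduced_homology Q m) <= tfrank (reduced_homology P m))%N.
Proof.
case: m => [m|[|m]].
- apply: (tfrank_homology_onto (i := push (@phi_s m.+1)) _
    (is_tfrank_reduced_homology Q m) (is_tfrank_reduced_homology P m)).
    by move=> a; exists (push (@phi_s m.+2) a); apply: bd_push.
  move=> z z_cyc; exists (pull (@phi_s m.+1) z), 0; rewrite raddf0 addr0 /= push_phiK.
  split=> //; apply: (can_inj (pushK (@phi_s_inj m))).
  by rewrite -bd_push push_phiK z_cyc raddf0.
- apply: (tfrank_homology_onto (i := push (@phi_s 0)) _
    (is_tfrank_reduced_homology Q (Negz 0)) (is_tfrank_reduced_homology P (Negz 0))).
    by move=> a; exists (push (@phi_s 1) a); apply: bd_push.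
  by move=> z z_cyc; exists (pull (@phi_s 0) z), 0; rewrite raddf0 addr0 /= push_phiK.
- by [].
Qed.

End PosetIso.

(** * Subgroup and coset posets *)

Section CosetPosets.
Variable gT : finGroupType.
Implicit Types (G K H : {group gT}) (ok : {group gT} -> bool).
Local Open Scope group_scope.

Lemma lt_set (A B : {set gT}) : (A < B)%O = (A \proper B).
Proof. by rewrite lt_def properEneq eq_sym. Qed.

Lemma sum_bigcup_leq (I J : finType) (P : pred I) (A : I -> {set J}) (F : J -> nat) :
  (\sum_(x in \bigcup_(i | P i) A i) F x <= \sum_(i | P i) \sum_(x in A i) F x)%N.
Proof.
rewrite (exchange_big_dep (mem (\bigcup_(i | P i) A i))) /=; last first.
  by move=> i x Pi Aix; apply/bigcupP; exists i.
apply: leq_sum => x /bigcupP[i Pi Aix].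
by rewrite (bigD1 i) ?Pi //= leq_addr.
Qed.

(** A common generalization of CG (all K are ok) and SG (K nontrivial is ok). *)
Definition coset_poset ok (G : {set gT}) : {set {set gT}} :=
  \bigcup_(K : {group gT} | ok K && (K \proper G)) lcosets K G.

Lemma coset_posetP ok G (y : {set gT}) :
  reflect (exists K g, [/\ ok K, K \proper G, g \in G & y = g *: K])
          (y \in coset_poset ok G).
Proof.
apply: (iffP bigcupP) => [[K /andP[okK KG] /lcosetsP[g Gg ->]]|[K [g [okK KG Gg ->]]]].
  by exists K, g.
by exists K; [rewrite okK | apply/lcosetsP; exists g].
Qed.

Lemma proper_lcoset (x : gT) (A B : {set gT}) : (x *: A \proper x *: B) = (A \proper B).
Proof. by rewrite !properE !lcosetS. Qed.

(** If a coset uH is contained in K, then u, which belongs to uH, lies in K, and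
    translating by u^-1 shows that H is contained in K: thus the cosets inside K
    that come from G are those that come from K. *)
Lemma lcoset_below ok G K g (y : {set gT}) : K \proper G -> g \in G ->
  (g *: y \in strictly_below (coset_poset ok G) (g *: K)) = (y \in coset_poset ok K).
Proof.
move=> KG Gg; rewrite inE lt_set proper_lcoset.
apply/andP/coset_posetP => [[/coset_posetP[H [x [okH HG Gx E]]] yK]|
                            [H [k [okH HK Kk ->]]]].
  have yE : y = (g^-1 * x) *: H by rewrite lcosetM -E lcosetK.
  have Kgx : g^-1 * x \in K by rewrite (subsetP (proper_sub yK)) // yE lcoset_refl.
  exists H, (g^-1 * x); split=> //.
  by rewrite -(proper_lcoset (g^-1 * x)) (lcoset_id Kgx) -yE.
split; last by have := proper_lcoset k H K; rewrite (lcoset_id Kk) => ->.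
apply/coset_posetP; exists H, (g * k); rewrite -lcosetM; split=> //.
  exact: proper_trans KG.
by rewrite groupM // (subsetP (proper_sub KG)).
Qed.

Lemma tfrank_homology_coset_poset ok G m :
  (tfrank (homology (coset_poset ok G) m) <=
     \sum_(K : {group gT} | ok K && (K \proper G))
        #|G : K| * tfrank (reduced_homology (coset_poset ok K) (m%:Z - 1)%R))%N.
Proof.
apply: leq_trans (tfrank_homology_poset _ m) _.
apply: leq_trans (sum_bigcup_leq _ _ _) _; apply: leq_sum => K /andP[okK KG].
rewrite -card_lcosets -sum_nat_const; apply: leq_sum => _ /lcosetsP[g Gg ->].
have lcosetgK : cancel (fun y : {set gT} => g *: y) (fun y => g^-1 *: y).
  exact: lcosetK.
have lcosetgVK : cancel (fun y : {set gT} => g^-1 *: y) (fun y => g *: y).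
  exact: lcosetKV.
apply: (@tfrank_reduced_homology_iso _ _ _ _ _ _ (fun y => g *: y) (fun y => g^-1 *: y)).
- by move=> y; rewrite lcoset_below.
- by move=> y; rewrite -{1}[y]lcosetgVK lcoset_below.
- by move=> y z _ _; rewrite !lt_set proper_lcoset.
- by move=> y z _ _; rewrite !lt_set proper_lcoset.
- exact: in1W.
- exact: in1W.
Qed.

Lemma CG_coset_poset G : CG G = coset_poset xpredT G.
Proof. by []. Qed.

(** The one-element cosets are exactly the cosets of the trivial subgroup. *)
Lemma SG_coset_poset G : SG G = coset_poset (fun K => 1%G \proper K) G.
Proof.
apply/setP => y; rewrite inE CG_coset_poset.
apply/andP/coset_posetP => [[y1 /coset_posetP[K [g [_ KG Gg yE]]]]|
                            [K [g [K1 KG Gg ->]]]].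
  exists K, g; split=> //; rewrite proper1G; apply: contra y1 => /eqP K1.
  by apply/imsetP; exists g; rewrite // yE K1 mulg1.
split; last by apply/coset_posetP; exists K, g.
apply/imsetP => -[h _ /(congr1 (fun A : {set gT} => #|A|))].
rewrite card_lcoset cards1 => K1'; move: K1; rewrite proper1G.
by rewrite trivg_card1 K1'.
Qed.

Lemma strictly_below_LG G K : K \proper G -> strictly_below (LG G) K = LG K.
Proof.
move=> KG; apply/setP => y; rewrite inE lt_set.
apply/andP/imsetP => [[/imsetP[H + ->] HK]|[H + ->]]; rewrite !inE => /andP[H1 HG].
  by exists H; rewrite // !inE H1.
split=> //; apply/imsetP; exists H; rewrite // !inE H1.
exact: proper_trans HG KG.
Qed.

End CosetPosets.

Theorem theorem6p1 (gT : finGroupType) (G : {group gT}) (m : nat) :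
  [/\ (tfrank (homology (LG G) m) <=
         \sum_(K : {group gT} | (1%G \proper K) && (K \proper G))
            tfrank (reduced_homology (LG K) (m%:Z - 1)%R))%N,
      (tfrank (homology (CG G) m) <=
         \sum_(K : {group gT} | K \proper G)
            #|G : K|%g * tfrank (reduced_homology (CG K) (m%:Z - 1)%R))%N
    & (tfrank (homology (SG G) m) <=
         \sum_(K : {group gT} | (1%G \proper K) && (K \proper G))
            #|G : K|%g * tfrank (reduced_homology (SG K) (m%:Z - 1)%R))%N].
Proof.
split.
- apply: leq_trans (tfrank_homology_poset _ m) _.
  rewrite big_imset /=; last by move=> H K _ _; apply: val_inj.
  apply/eq_leq/eq_big => K; rewrite !inE // => /andP[_ KG].
  by rewrite strictly_below_LG.
- exact: (tfrank_homology_coset_poset xpredT).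
- rewrite SG_coset_poset; under eq_bigr do rewrite SG_coset_poset.
  exact: tfrank_homology_coset_poset.
Qed.
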